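(* Let $k$ be a field of prime characteristic $p$ and $d$ a positive integer. Define $T$-spaces $S^{(d)}_n$ of $k_0\langle X\rangle$ by $S^{(d)}_1=\{S^{(d)}\}^S$ and $S^{(d)}_{n+1}=(S^{(d)}_nS^{(d)}_1)^S$ for $n\ge1$, where $S^{(d)}=\sum_{\sigma\in\Sigma_d}\prod_{i=1}^d x_{\sigma(i)}$. Let $I: i_1<i_2<\cdots$ be any increasing sequence of positive integers (finite with at least two terms, or infinite) with initial gap $g=i_2-i_1$, and let $R^{(d)}_{\infty,I}$ be the $T$-space generated by $\bigcup_{i\in I}S^{(d)}_i$. Then $R^{(d)}_{\infty,I}$ is finitely based: it is generated as a $T$-space by a set of at most $g+1$ elements.
   Context: $X=\{x_1,x_2,\ldots\}$ is countably infinite; $k_0\langle X\rangle$ is the free associative (non-unital) $k$-algebra on $X$. A $T$-space is a $k$-subspace of $k_0\langle X\rangle$ invariant under every algebra endomorphism of $k_0\langle X\rangle$; $(A)^S$ is the $T$-space generated by a subset $A$. For subsets $A,B$, $AB=\{ab:a\in A,b\in B\}$. $\Sigma_d$ is the symmetric group on $d$ letters. A $T$-space basis of a $T$-space $V$ is a subset generating $V$ as a $T$-space. *)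

(* Defs.v *)
(* The free non-unital associative algebra k_0<X> on
   X = {x_0, x_1, ...} is modelled as the finitely supported functions
   (seq nat -> k) vanishing on the empty word: f w is the coefficient of the
   monomial x_{w_1} ... x_{w_n}. *)
From mathcomp Require Import all_boot all_order all_algebra all_fingroup.
Set Implicit Arguments. Unset Strict Implicit. Unset Printing Implicit Defensive.
Import GRing.Theory.
Local Open Scope ring_scope.

Section FreeAlg.
Variable k : fieldType.

Definition fpoly := seq nat -> k.

Definition is_poly (f : fpoly) : Prop :=
  f [::] = 0 /\ exists s : seq (seq nat), forall w, f w != 0 -> w \in s.

Definition pzero : fpoly := fun _ => 0.
Definition padd (f g : fpoly) : fpoly := fun w => f w + g w.
Definition pscale (c : k) (f : fpoly) : fpoly := fun w => c * f w.
Definition pmul (f g : fpoly) : fpoly :=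
  fun w => \sum_(i < (size w).+1) f (take i w) * g (drop i w).

Fixpoint evalw (phi : nat -> fpoly) (w : seq nat) : fpoly :=
  match w with
  | [::] => pzero
  | a :: w' => if w' is [::] then phi a else pmul (phi a) (evalw phi w')
  end.

(* image of f under the endomorphism x_i |-> phi i, computed using a
   duplicate-free list s containing the support of f *)
Definition subst_on (s : seq (seq nat)) (phi : nat -> fpoly) (f : fpoly) : fpoly :=
  fun u => \sum_(w <- s) f w * evalw phi w u.

Definition is_Tspace (V : fpoly -> Prop) : Prop :=
  [/\ (forall f, V f -> is_poly f),
      V pzero,
      (forall f g, V f -> V g -> V (padd f g)),
      (forall c f, V f -> V (pscale c f)) &
      (forall phi : nat -> fpoly, (forall i, is_poly (phi i)) ->
         forall f s, V f -> uniq s -> (forall w, f w != 0 -> w \in s) ->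
         V (subst_on s phi f))].

Definition Tgen (A : fpoly -> Prop) : fpoly -> Prop :=
  fun f => forall V, is_Tspace V -> (forall a, A a -> V a) -> V f.

Definition prodset (A B : fpoly -> Prop) : fpoly -> Prop :=
  fun f => exists a b, [/\ A a, B b & f = pmul a b].

Definition Sd (d : nat) : fpoly :=
  fun u => \sum_(s : 'S_d) (u == [seq val (s i) | i <- enum 'I_d])%:R.

Definition S1 (d : nat) : fpoly -> Prop := Tgen (fun f => f = Sd d).

(* Sn d n = S^(d)_n for n >= 1 (Sn d 0 is empty and unused) *)
Fixpoint Sn (d n : nat) : fpoly -> Prop :=
  match n with
  | 0 => fun _ => False
  | n'.+1 => if n' is 0 then S1 d else Tgen (prodset (Sn d n') (S1 d))
  end.

Definition Rinf (d : nat) (I : nat -> Prop) : fpoly -> Prop :=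
  Tgen (fun f => exists2 i, I i & Sn d i f).

(* propositional list membership (fpoly has no decidable equality) *)
Fixpoint inseq (B : seq fpoly) (b : fpoly) : Prop :=
  if B is c :: B' then b = c \/ inseq B' b else False.

End FreeAlg.

(* Main.v *)
Require Import Defs.
From HB Require Import structures.
From mathcomp Require Import all_boot all_order all_algebra all_fingroup.
From mathcomp Require Import boolp.
Set Implicit Arguments. Unset Strict Implicit. Unset Printing Implicit Defensive.
Import GRing.Theory.
Local Open Scope ring_scope.

(* Write S for S_1 and S^n for S_n, which is the span of the n-fold products of
   elements of S, and [a, x] = ax - xa. As S is spanned by the symmetrised
   products D(u_1, ..., u_d), we have [a, S] <= S, hence [a, S^n] <= S^n for
   every a; moreover [a, xs] = [sa, x] + [ax, s] gives [a, S^n] <= S by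
   induction on n. Write D(y) = sum L y R for the symmetrised product as a
   function of one argument, and let e, f lie in S^g. Then
     D(v)fe = D(vf)e - D(vef) + D(ve)f + sum L v [[R, f], e],
   and y[G, e] = [yG, e] + [e, y]G lies in S + S^(1+g) for G = [R, f] in S^g.
   Hence S^(1+2g) <= S + S^(1+g), and multiplying by S^(n-1) yields
   S^(n+2g) <= S^n + S^(n+g). So S^(i1) and S^(i2) produce S^i for all i in the
   progression i1 + tg, and each index outside the progression that has to be
   added makes the common difference drop; at most g - 1 are needed. *)

(* Noncommutative formal power series: unlike the polynomials without constant
   term they form a unital ring, in which pmul is the product. *)
Definition series (k : fieldType) : Type := fpoly k.

(** * The unital algebra of noncommutative power series *)

Section Series.
Variable k : fieldType.
Implicit Types (f g h : series k) (w : seq nat).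

Definition sadd f g : series k := padd f g.
Definition sopp f : series k := fun w => - f w.
Definition smul f g : series k := pmul f g.
Definition sone : series k := fun w => (w == [::])%:R.
(** Left quotient by a letter: it turns the sum over the cut points of a word into the recursion
    [smul_cons]. *)
Definition stail (a : nat) f : series k := fun w => f (a :: w).

HB.instance Definition _ := gen_eqMixin (series k).
HB.instance Definition _ := gen_choiceMixin (series k).

Lemma saddA : associative sadd.
Proof. by move=> f g h; apply/funext => w; apply: addrA. Qed.

Lemma saddC : commutative sadd.
Proof. by move=> f g; apply/funext => w; apply: addrC. Qed.

Lemma sadd0 : left_id (@pzero k : series k) sadd.
Proof. by move=> f; apply/funext => w; apply: add0r. Qed.

Lemma saddN : left_inverse (@pzero k : series k) sopp sadd.
Proof. by move=> f; apply/funext => w; apply: addNr. Qed.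

HB.instance Definition _ :=
  GRing.isZmodule.Build (series k) saddA saddC sadd0 saddN.

Lemma smul_nil f g : smul f g [::] = f [::] * g [::].
Proof. by rewrite /smul /pmul big_ord_recl big_ord0 addr0. Qed.

Lemma smul_cons f g a w :
  smul f g (a :: w) = f [::] * g (a :: w) + smul (stail a f) g w.
Proof. by rewrite /smul /pmul big_ord_recl. Qed.

Lemma smulDl : left_distributive smul sadd.
Proof.
move=> f g h; apply/funext => w; rewrite /smul /sadd /padd /pmul -big_split /=.
by apply: eq_bigr => i _; rewrite mulrDl.
Qed.

Lemma smulDr : right_distributive smul sadd.
Proof.
move=> f g h; apply/funext => w; rewrite /smul /sadd /padd /pmul -big_split /=.
by apply: eq_bigr => i _; rewrite mulrDr.
Qed.

Lemma smul_scalel c f g : smul (pscale c f) g = pscale c (smul f g).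
Proof.
apply/funext => w; rewrite /smul /pscale /pmul big_distrr /=.
by apply: eq_bigr => i _; rewrite mulrA.
Qed.

Lemma smul_scaler c f g : smul f (pscale c g) = pscale c (smul f g).
Proof.
apply/funext => w; rewrite /smul /pscale /pmul big_distrr /=.
by apply: eq_bigr => i _; rewrite mulrCA.
Qed.

Lemma smulA : associative smul.
Proof.
move=> f g h; apply/funext => w; elim: w f g => [|a w IHw] f g.
  by rewrite !smul_nil mulrA.
have tail_mul : stail a (smul f g)
    = sadd (pscale (f [::]) (stail a g)) (smul (stail a f) g).
  by apply/funext => v; apply: smul_cons.
rewrite [LHS]smul_cons [RHS]smul_cons tail_mul smulDl IHw smul_nil.
rewrite smul_scalel smul_cons mulrDr -[in RHS]mulrA -addrA; congr (_ + _).
Qed.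

Lemma smul1 : left_id sone smul.
Proof.
move=> f; apply/funext => -[|a w]; first by rewrite smul_nil mul1r.
rewrite smul_cons mul1r /smul /pmul big1 ?addr0 // => i _.
by rewrite /stail /sone mul0r.
Qed.

Lemma smulr1 : right_id sone smul.
Proof.
move=> f; apply/funext => w; elim: w f => [|a w IHw] f.
  by rewrite smul_nil mulr1.
by rewrite smul_cons IHw /sone mulr0 add0r.
Qed.

Lemma sone_neq0 : sone != (0 : series k).
Proof.
by apply/eqP => /(congr1 (fun f => f [::])) /eqP; rewrite oner_eq0.
Qed.

HB.instance Definition _ := GRing.Zmodule_isNzRing.Build (series k)
  smulA smul1 smulr1 smulDl smulDr sone_neq0.

Definition sscale c f : series k := pscale c f.

Lemma sscaleA a b f : sscale a (sscale b f) = sscale (a * b) f.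
Proof. by apply/funext => w; apply: mulrA. Qed.

Lemma sscale1 : left_id 1 sscale.
Proof. by move=> f; apply/funext => w; apply: mul1r. Qed.

Lemma sscaleDr : right_distributive sscale +%R.
Proof. by move=> c f g; apply/funext => w; apply: mulrDr. Qed.

Lemma sscaleDl f : {morph sscale^~ f : a b / a + b}.
Proof. by move=> a b; apply/funext => w; apply: mulrDl. Qed.

HB.instance Definition _ := GRing.Zmodule_isLmodule.Build k (series k)
  sscaleA sscale1 sscaleDr sscaleDl.

Lemma sscaleAl c f g : c *: (f * g) = (c *: f) * g.
Proof. by rewrite -[RHS]/(smul (pscale c f) g) smul_scalel. Qed.

HB.instance Definition _ := GRing.Lmodule_isLalgebra.Build k (series k) sscaleAl.

Lemma sscaleAr c f g : c *: (f * g) = f * (c *: g).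
Proof. by rewrite -[RHS]/(smul f (pscale c g)) smul_scaler. Qed.

HB.instance Definition _ := GRing.Lalgebra_isAlgebra.Build k (series k) sscaleAr.

Lemma pmulE f g : pmul f g = f * g :> series k. Proof. by []. Qed.
Lemma seriesD f g w : (f + g) w = f w + g w. Proof. by []. Qed.
Lemma seriesZ c f w : (c *: f) w = c * f w. Proof. by []. Qed.
Lemma seriesM0 f g : (f * g) [::] = f [::] * g [::].
Proof. exact: smul_nil. Qed.

Lemma series_sum (T : Type) (r : seq T) (P : pred T) (F : T -> series k) w :
  (\sum_(i <- r | P i) F i) w = \sum_(i <- r | P i) F i w.
Proof. by elim/big_rec2: _ => // i x y _ <-. Qed.

End Series.

(** * Finite supports and polynomials *)

Section FiniteSupport.
Variable k : fieldType.
Implicit Types (f g : series k).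

Definition finsupp f : Prop :=
  exists s : seq (seq nat), forall w, f w != 0 -> w \in s.

Lemma poly_fin f : is_poly f -> finsupp f.
Proof. by case. Qed.

Lemma fin0 : finsupp (0 : series k).
Proof. by exists [::] => w; rewrite eqxx. Qed.

Lemma fin1 : finsupp (1 : series k).
Proof. by exists [:: [::]] => -[//|a w]; rewrite eqxx. Qed.

Lemma finD f g : finsupp f -> finsupp g -> finsupp (f + g).
Proof.
move=> [s sP] [t tP]; exists (s ++ t) => w; rewrite mem_cat seriesD.
have [->|/sP -> //] := eqVneq (f w) 0.
by rewrite add0r => /tP ->; rewrite orbT.
Qed.

Lemma finZ c f : finsupp f -> finsupp (c *: f).
Proof.
move=> [s sP]; exists s => w; rewrite seriesZ => cf_neq0; apply: sP.
by apply: contraNneq cf_neq0 => ->; rewrite mulr0.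
Qed.

Lemma finM f g : finsupp f -> finsupp g -> finsupp (f * g).
Proof.
move=> [s sP] [t tP]; exists [seq u ++ v | u <- s, v <- t] => w fgw.
(* A nonzero coefficient of the product forces a cut of [w] at which both coefficients are
   nonzero. *)
have [i /andP[fi gi]|fg0] :=
    pickP (fun i : 'I_(size w).+1 => (f (take i w) != 0) && (g (drop i w) != 0)).
  by apply/allpairsP; exists (take i w, drop i w);
    split; rewrite ?cat_take_drop ?sP ?tP.
case/eqP: fgw; rewrite -[LHS]/(pmul f g w) /pmul big1 // => i _.
by have /negbT := fg0 i; rewrite -negb_or negbK -mulf_eq0 => /eqP.
Qed.

Lemma fin_prod (T : Type) (r : seq T) (F : T -> series k) :
  (forall i, finsupp (F i)) -> finsupp (\prod_(i <- r) F i).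
Proof. by move=> finF; elim/big_ind: _ => //; [exact: fin1 | exact: finM]. Qed.

Lemma fin_sum (T : Type) (r : seq T) (F : T -> series k) :
  (forall i, finsupp (F i)) -> finsupp (\sum_(i <- r) F i).
Proof. by move=> finF; elim/big_ind: _ => //; [exact: fin0 | exact: finD]. Qed.

Lemma poly0 : is_poly (0 : series k).
Proof. by split=> //; apply: fin0. Qed.

Lemma polyD f g : is_poly f -> is_poly g -> is_poly (f + g : series k).
Proof.
by move=> [f0 ff] [g0 fg]; split; [rewrite seriesD f0 g0 addr0 | exact: finD].
Qed.

Lemma polyZ c f : is_poly f -> is_poly (c *: f : series k).
Proof. by move=> [f0 ff]; split; [rewrite seriesZ f0 mulr0 | exact: finZ]. Qed.

(** One factor without constant term suffices, so the other may be an empty product. *)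
Lemma polyM_finl f g : finsupp f -> is_poly g -> is_poly (f * g : series k).
Proof.
by move=> ff [g0 fg]; split; [rewrite seriesM0 g0 mulr0 | exact: finM].
Qed.

Lemma polyM_finr f g : is_poly f -> finsupp g -> is_poly (f * g : series k).
Proof.
by move=> [f0 ff] fg; split; [rewrite seriesM0 f0 mul0r | exact: finM].
Qed.

Lemma poly_sum (T : Type) (r : seq T) (F : T -> series k) :
  (forall i, is_poly (F i)) -> is_poly (\sum_(i <- r) F i : series k).
Proof.
by move=> polyF; elim/big_ind: _ => //; [exact: poly0 | exact: polyD].
Qed.

End FiniteSupport.

(** * Commutators *)

Definition lie (R : pzRingType) (a x : R) : R := a * x - x * a.

Section Lie.
Variable R : pzRingType.
Implicit Types a x y : R.

Lemma lie1 a : lie a 1 = 0.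
Proof. by rewrite /lie mulr1 mul1r subrr. Qed.

Lemma lie0 a : lie a 0 = 0.
Proof. by rewrite /lie mulr0 mul0r subrr. Qed.

Lemma lieD a x y : lie a (x + y) = lie a x + lie a y.
Proof. by rewrite /lie mulrDr mulrDl opprD addrACA. Qed.

Lemma lie_sum a (T : Type) (r : seq T) (F : T -> R) :
  lie a (\sum_(i <- r) F i) = \sum_(i <- r) lie a (F i).
Proof. by apply: (big_morph (lie a)); [exact: lieD | exact: lie0]. Qed.

Lemma lieM a x y : lie a (x * y) = lie a x * y + x * lie a y.
Proof.
by rewrite /lie mulrBl mulrBr !mulrA addrA subrK.
Qed.

(** Rotating a factor into the left slot turns a commutator with a product into commutators with its
    single factors. *)
Lemma lieM_cyclic a x y : lie a (x * y) = lie (a * x) y + lie (y * a) x.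
Proof.
by rewrite /lie !mulrA addrA subrK.
Qed.

(** Leibniz rule; the factor acted on is marked by the value of its index, whence [uniq r]. *)
Lemma lie_prod a (T : eqType) (r : seq T) (F : T -> R) : uniq r ->
  lie a (\prod_(i <- r) F i) =
  \sum_(i <- r) \prod_(j <- r) (if j == i then lie a (F j) else F j).
Proof.
elim: r => [|i r IHr] /=; first by rewrite !big_nil lie1.
case/andP=> i_notin_r /IHr {}IHr; rewrite !big_cons lieM IHr eqxx big_distrr /=.
congr (_ + _).
  congr (_ * _); apply: eq_big_seq => j j_r.
  by case: eqP => // ji; rewrite -ji j_r in i_notin_r.
apply: eq_big_seq => j j_r; rewrite big_cons.
by case: eqP => // ij; rewrite ij j_r in i_notin_r.
Qed.

End Lie.

(** * Symmetrised products and the spans of their n-fold products *)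

Section Symmetrised.
Variables (k : fieldType) (d : nat).
Implicit Types (a x y : series k) (u : nat -> series k).

Definition symm u : series k := \sum_(s : 'S_d) \prod_(i < d) u (s i).

Definition upd u (m : nat) y (n : nat) : series k := if n == m then y else u n.

Lemma lie_symm a u : lie a (symm u) = \sum_(m < d) symm (upd u m (lie a (u m))).
Proof.
rewrite /symm lie_sum exchange_big /=; apply: eq_bigr => s _.
(* Position [i] carries argument [s i]; reindexing by [s] makes the sum over arguments one over
   positions. *)
rewrite lie_prod ?index_enum_uniq // [RHS](reindex_inj (@perm_inj _ s)) /=.
apply: eq_bigr => i _; apply: eq_bigr => j _; rewrite /upd.
by rewrite (inj_eq val_inj) (inj_eq perm_inj); case: eqP => [->|].
Qed.

(** A linear span without closure under endomorphisms, so that membership allows induction on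
    products; [Sn_powS] identifies it with S_n for positive n. Level 0 consists of the scalars. *)
Inductive powS : nat -> series k -> Prop :=
| powS0 n : powS n 0
| powSD n x y : powS n x -> powS n y -> powS n (x + y)
| powSZ n c x : powS n x -> powS n (c *: x)
| powS_one : powS 0 1
| powS_symm n x u : powS n x -> (forall i, is_poly (u i)) ->
    powS n.+1 (x * symm u).

Lemma powS_sum n (T : Type) (r : seq T) (F : T -> series k) :
  (forall i, powS n (F i)) -> powS n (\sum_(i <- r) F i).
Proof.
by move=> PF; elim/big_ind: _ => //; [exact: powS0 | exact: powSD].
Qed.

Lemma powSM m n x y : powS m x -> powS n y -> powS (m + n) (x * y).
Proof.
move=> Px; elim=> {n y} [n|n y z _ IHy _ IHz|n c y _ IHy||n y u _ IHy Pu].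
- by rewrite mulr0; apply: powS0.
- by rewrite mulrDr; apply: powSD.
- by rewrite -scalerAr; apply: powSZ.
- by rewrite mulr1 addn0.
- by rewrite mulrA addnS; apply: powS_symm.
Qed.

Lemma powS1_symm u : (forall i, is_poly (u i)) -> powS 1 (symm u).
Proof. by move=> Pu; rewrite -[symm u]mul1r; apply/powS_symm/Pu/powS_one. Qed.

Lemma fin_symm u : (forall i, is_poly (u i)) -> finsupp (symm u).
Proof.
by move=> Pu; apply: fin_sum => s; apply: fin_prod => i; apply: poly_fin.
Qed.

Lemma fin_powS n x : powS n x -> finsupp x.
Proof.
elim=> {n x} [n|n x y _ Px _ Py|n c x _ Px||n x u _ Px Pu].
- exact: fin0.
- exact: finD.
- exact: finZ.
- exact: fin1.
- by apply: finM => //; apply: fin_symm.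
Qed.

Lemma lie_poly a x : finsupp a -> is_poly x -> is_poly (lie a x : series k).
Proof.
move=> fa Px; rewrite /lie -scaleN1r; apply: polyD; first exact: polyM_finl.
by apply/polyZ/polyM_finr.
Qed.

Lemma powS_lie_symm a u : finsupp a -> (forall i, is_poly (u i)) ->
  powS 1 (lie a (symm u)).
Proof.
move=> fa Pu; rewrite lie_symm; apply: powS_sum => m; apply: powS1_symm => i.
by rewrite /upd; case: ifP => // _; apply: lie_poly.
Qed.

Lemma lieZ a c x : lie a (c *: x) = c *: lie a x.
Proof. by rewrite /lie -scalerAr -scalerAl scalerBr. Qed.

Lemma powS_lie n a x : finsupp a -> powS n x -> powS n (lie a x).
Proof.
move=> fa; elim=> {n x} [n|n x y _ Px _ Py|n c x _ Px||n x u Sx Px Pu].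
- by rewrite lie0; apply: powS0.
- by rewrite lieD; apply: powSD.
- by rewrite lieZ; apply: powSZ.
- by rewrite lie1; apply: powS0.
rewrite lieM; apply: powSD; first exact: powS_symm.
by rewrite -addn1; apply: powSM => //; apply: powS_lie_symm.
Qed.

Lemma powS1_lie n a x : finsupp a -> powS n x -> powS 1 (lie a x).
Proof.
move=> fa Sx; elim: Sx a fa => {n x}
    [n|n x y _ Px _ Py|n c x _ Px||n x u Sx Px Pu] a fa.
- by rewrite lie0; apply: powS0.
- by rewrite lieD; apply: powSD; auto.
- by rewrite lieZ; apply/powSZ/Px.
- by rewrite lie1; apply: powS0.
(* The first term is a commutator with one symmetrised product; the second falls to the induction
   hypothesis, with [symm d u * a] in place of [a]. *)
rewrite lieM_cyclic; apply: powSD.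
  by apply: powS_lie_symm => //; apply: finM => //; apply: fin_powS Sx.
by apply: Px; apply: finM => //; apply: fin_symm.
Qed.

End Symmetrised.

(** * The inclusion S^(n+2g) <= S^n + S^(n+g) *)

Section Reduction.
Variables (k : fieldType) (d : nat).
Hypothesis d_gt0 : (0 < d)%N.
Implicit Types (x y e f v : series k) (u : nat -> series k).

(** Linearity alone passes to the predicates [V (x * _)] and [V (_ * y)], by which outer factors are
    absorbed; invariance under endomorphisms would be lost there. *)
Definition lin_closed (V : series k -> Prop) : Prop :=
  [/\ V 0, forall x y, V x -> V y -> V (x + y) & forall c x, V x -> V (c *: x)].

Lemma lin_closed_mull (V : series k -> Prop) x :
  lin_closed V -> lin_closed (fun z => V (x * z)).
Proof.
move=> [V0 VD VZ]; split=> [|z t Vz Vt|c z Vz]; first by rewrite mulr0.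
  by rewrite mulrDr; apply: VD.
by rewrite -scalerAr; apply: VZ.
Qed.

Lemma lin_closed_mulr (V : series k -> Prop) y :
  lin_closed V -> lin_closed (fun z => V (z * y)).
Proof.
move=> [V0 VD VZ]; split=> [|z t Vz Vt|c z Vz]; first by rewrite mul0r.
  by rewrite mulrDl; apply: VD.
by rewrite -scalerAl; apply: VZ.
Qed.

Lemma lin_closed_sum (V : series k -> Prop) (T : Type) (r : seq T)
    (F : T -> series k) :
  lin_closed V -> (forall i, V (F i)) -> V (\sum_(i <- r) F i).
Proof. by move=> [V0 VD _] VF; apply: big_ind. Qed.

Lemma powS_succ_ind n (V : series k -> Prop) : lin_closed V ->
  (forall x u, powS d n x -> (forall i, is_poly (u i)) -> V (x * symm d u)) ->
  forall x, powS d n.+1 x -> V x.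
Proof.
move=> [V0 VD VZ] Vmul x; move Dm: n.+1 => m Sx.
elim: Sx Dm => {m x} // [m x y _ IHx _ IHy Dm|m c x _ IHx Dm|m x u Sx _ Pu [Dm]].
- by apply: VD; auto.
- by apply: VZ; auto.
- by rewrite -Dm in Sx; apply: Vmul.
Qed.

Lemma powS_add_ind m n (V : series k -> Prop) : lin_closed V ->
  (forall x y, powS d m x -> powS d n y -> V (x * y)) ->
  forall x, powS d (m + n) x -> V x.
Proof.
elim: n V => [|n IHn] V linV Vmul x.
  by rewrite addn0 => Sx; rewrite -[x]mulr1; apply: Vmul => //; apply: powS_one.
rewrite addnS; apply: powS_succ_ind => // {}x u Sx Pu.
apply: (IHn (fun z => V (z * symm d u))) Sx => [|y z Sy Sz].
  exact: lin_closed_mulr.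
by rewrite -mulrA; apply: Vmul => //; apply: powS_symm.
Qed.

Lemma eq_symm u1 u2 : (forall i, (i < d)%N -> u1 i = u2 i) ->
  symm d u1 = symm d u2.
Proof. by move=> eq_u; apply: eq_bigr => s _; apply: eq_bigr => i _; apply: eq_u. Qed.

(** Argument 0 occurs exactly once in each product; [L s] and [R s] are the products before and
    after it, possibly empty and so only finitely supported. *)
Lemma symm_upd_split u : (forall i, is_poly (u i)) ->
  exists L R : 'S_d -> series k,
    [/\ forall s, finsupp (L s), forall s, finsupp (R s)
      & forall y, symm d (upd u 0 y) = \sum_s L s * y * R s].
Proof.
move=> Pu; pose i0 := Ordinal d_gt0.
have split1 (s : 'S_d) : exists LR : series k * series k,
    [/\ finsupp LR.1, finsupp LR.2
      & forall y, \prod_(i < d) upd u 0 y (s i) = LR.1 * y * LR.2].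
  (* The positions are cut at the one that [s] sends to 0; uniqueness keeps it out of both
     pieces. *)
  have := index_enum_uniq 'I_d; have := mem_index_enum (s^-1%g i0).
  case/splitPr => r1 r2; rewrite cat_uniq /= negb_or => /and3P[_ /andP[Hr1 _]].
  case/andP=> Hr2 _.
  exists (\prod_(i <- r1) u (s i), \prod_(i <- r2) u (s i)); split=> [||y].
  - by apply: fin_prod => i; apply: poly_fin.
  - by apply: fin_prod => i; apply: poly_fin.
  have upd_other r : s^-1%g i0 \notin r ->
      \prod_(i <- r) upd u 0 y (s i) = \prod_(i <- r) u (s i).
    move=> r'i0; apply: eq_big_seq => i r_i; rewrite /upd.
    have -> : (s i == 0%N :> nat) = (s i == i0) by [].
    by case: eqP => // si; rewrite -si permK r_i in r'i0.
  rewrite big_cat big_cons !upd_other //= mulrA; congr (_ * _ * _).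
  by rewrite permKV /upd.
have [LR LRP] := choice split1.
exists (fun s => (LR s).1), (fun s => (LR s).2); split=> [s|s|y].
- by have [] := LRP s.
- by have [] := LRP s.
- by apply: eq_bigr => s _; have [_ _ ->] := LRP s.
Qed.

(* x[y, e] = [xy, e] - [x, e]y, where the first term lies in S and the second
   in S S^g. *)
Lemma mul_lie_red g (V : series k -> Prop) x y e : lin_closed V ->
  (forall z, powS d 1 z -> V z) -> (forall z, powS d g.+1 z -> V z) ->
  finsupp x -> powS d g y -> powS d g e -> V (x * lie y e).
Proof.
move=> [_ VD VZ] V1 Vg fx Sy Se.
have -> : x * lie y e = lie (x * y) e + (-1) *: (lie x e * y).
  by rewrite scaleN1r /lie mulrBr mulrBl !mulrA opprB subrKA.
apply: VD; first by apply: V1; apply: powS1_lie Se; apply/finM/(fin_powS Sy).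
by apply: VZ; apply: Vg; rewrite -add1n; apply: powSM => //; apply: powS1_lie Se.
Qed.

(** The case n = 1 of the reduction, from which the general case follows by multiplication on the
    left. *)
Lemma symm_mul_red g (V : series k -> Prop) u f e : lin_closed V ->
  (forall z, powS d 1 z -> V z) -> (forall z, powS d g.+1 z -> V z) ->
  (forall i, is_poly (u i)) -> powS d g f -> powS d g e ->
  V (symm d u * f * e).
Proof.
move=> linV V1 Vg Pu Sf Se; have [_ VD VZ] := linV.
have [fe ff] := (fin_powS Se, fin_powS Sf).
have [L [R [fL fR symmE]]] := symm_upd_split Pu.
pose v := u 0%N; have Pv : is_poly v by apply: Pu.
pose D y := symm d (upd u 0 y).
have SD y : is_poly y -> powS d 1 (D y).
  by move=> Py; apply: powS1_symm => i; rewrite /upd; case: ifP.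
(* Termwise, [[R, f], e] = Rfe - fRe - eRf + efR, and the three values of [D] cancel all but Rfe. *)
have -> : symm d u * f * e = D (v * f) * e + (-1) *: D (v * e * f)
    + D (v * e) * f + \sum_s L s * v * lie (lie (R s) f) e.
  have -> : symm d u = D v by apply: eq_symm => i _; rewrite /upd; case: eqP => [->|].
  rewrite /D !symmE !big_distrl /= scaler_sumr -!big_split /=.
  apply: eq_bigr => s _; rewrite scaleN1r /lie !(mulrBr, mulrBl) !mulrA.
  have cancel (A p q r : series k) : A = p + - q + r + (A - p - (r - q)).
    have -> : p + - q + r = p + (r - q) by rewrite addrAC addrA.
    by rewrite -[A - p - _]addrA -opprD [RHS]addrC subrK.
  exact: cancel.
(* In [mul_lie_red] take x = L v and y = [R, f], which lies in S^g. *)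
apply: (VD); last first.
  apply: lin_closed_sum => // s; apply: mul_lie_red Se => //.
    by apply/finM/poly_fin.
  exact: powS_lie.
have Pve : is_poly (v * e) by apply: polyM_finr.
apply: (VD); [apply: (VD) |].
- by apply: Vg; rewrite -add1n; apply: powSM => //; apply/SD/polyM_finr.
- by apply/VZ/V1/SD/polyM_finr.
- by apply: Vg; rewrite -add1n; apply: powSM => //; apply: SD.
Qed.

(* S^(n+2g) <= S^n + S^(n+g) *)
Lemma powS_red n g (V : series k -> Prop) : lin_closed V -> (0 < n)%N ->
  (forall z, powS d n z -> V z) -> (forall z, powS d (n + g) z -> V z) ->
  forall z, powS d (n + g.*2) z -> V z.
Proof.
(* A positive exponent provides a factor [symm d u] next to [y]; what stands to its left is absorbed
   into the predicate. *)
case: n => // n linV _ Vn Vng; rewrite -addnn.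
apply: powS_add_ind => // x y Sx Sy; move: x Sx.
apply: (powS_succ_ind (V := fun z => V (z * y))) => [|x u Sx Pu].
  exact: lin_closed_mulr.
move: y Sy; apply: powS_add_ind => [|f e Sf Se]; first exact: lin_closed_mull.
rewrite -mulrA [symm d u * _]mulrA.
apply: (@symm_mul_red g (fun z => V (x * z))) => // [|z Sz|z Sz].
- exact: lin_closed_mull.
- by apply: Vn; rewrite -addn1; apply: powSM.
- by apply: Vng; rewrite addSnnS; apply: powSM.
Qed.

End Reduction.

(** * Endomorphisms as substitutions *)

Section Substitution.
Variable k : fieldType.
Implicit Types (f g : series k) (w : seq nat) (s t : seq (seq nat)).
Implicit Type phi : nat -> series k.

Definition mon w : series k := fun v => (v == w)%:R.

Definition cover s f : Prop := uniq s /\ forall w, f w != 0 -> w \in s.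

(** Unlike [evalw], this takes the value 1 at the empty word and is therefore multiplicative. *)
Definition word_eval phi w : series k := \prod_(a <- w) phi a.

Definition sum_eval s phi f : series k := \sum_(w <- s) f w *: word_eval phi w.

Lemma mon_cat u v : mon (u ++ v) = mon u * mon v.
Proof.
elim: u => [|a u IHu] /=; first by rewrite [mon [::]](_ : _ = 1) ?mul1r.
apply/funext => -[|b w]; first by rewrite seriesM0 /mon mul0r.
have -> : (mon (a :: u) * mon v) (b :: w) = (stail b (mon (a :: u)) * mon v) w.
  by rewrite -pmulE -/(smul _ _) smul_cons /mon mul0r add0r.
have -> : stail b (mon (a :: u)) = (b == a)%:R *: mon u.
  by apply/funext => x; rewrite seriesZ /stail /mon eqseq_cons -mulnb natrM.
by rewrite -scalerAl -IHu seriesZ /mon eqseq_cons -mulnb natrM.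
Qed.

Lemma mon_nil : mon [::] = 1. Proof. by []. Qed.

Lemma cover_sum s f : cover s f -> f = \sum_(w <- s) f w *: mon w.
Proof.
move=> [s_uniq sP]; apply/funext => v; rewrite series_sum.
have [v_s|v's] := boolP (v \in s).
  rewrite (bigD1_seq v) //= big1 => [|w w_neq_v]; rewrite seriesZ /mon.
    by rewrite eqxx mulr1 addr0.
  by rewrite eq_sym (negbTE w_neq_v) mulr0.
rewrite big_seq big1 => [|w w_s]; first by apply/eqP; apply: contraNT v's; apply: sP.
by rewrite seriesZ /mon; case: eqP => [vw|_]; [rewrite vw w_s in v's | rewrite mulr0].
Qed.

Lemma cover_undup s f : (forall w, f w != 0 -> w \in s) -> cover (undup s) f.
Proof. by move=> sP; split=> [|w /sP]; rewrite ?undup_uniq ?mem_undup. Qed.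

Lemma sum_eval_linear s phi :
  linear (sum_eval s phi : series k -> series k).
Proof.
move=> c f g; rewrite /sum_eval scaler_sumr -big_split; apply: eq_bigr => w _.
by rewrite seriesD seriesZ scalerDl scalerA.
Qed.

Lemma sum_evalD s phi f g :
  sum_eval s phi (f + g) = sum_eval s phi f + sum_eval s phi g.
Proof. by rewrite -{1}[f]scale1r sum_eval_linear scale1r. Qed.

Lemma sum_eval0 s phi : sum_eval s phi 0 = 0.
Proof. by rewrite /sum_eval big1 // => w _; rewrite scale0r. Qed.

Lemma sum_evalZ s phi c f : sum_eval s phi (c *: f) = c *: sum_eval s phi f.
Proof. by rewrite -[c *: f]addr0 sum_eval_linear sum_eval0 addr0. Qed.

Lemma sum_eval_mon s phi w : uniq s -> w \in s ->
  sum_eval s phi (mon w) = word_eval phi w.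
Proof.
move=> s_uniq w_s; rewrite /sum_eval (bigD1_seq w) //= big1 => [|v /negbTE vw].
  by rewrite /mon eqxx scale1r addr0.
by rewrite /mon vw scale0r.
Qed.

Lemma sum_eval_cover s t phi f : cover s f -> cover t f ->
  sum_eval s phi f = sum_eval t phi f.
Proof.
(* Words outside the support contribute zero, so both lists can be compared with their
   duplicate-free union. *)
suff sub s1 t1 : cover s1 f -> uniq t1 -> {subset s1 <= t1} ->
    sum_eval s1 phi f = sum_eval t1 phi f.
  move=> cs ct; have [[us _] [ut _]] := (cs, ct).
  rewrite (sub s (undup (s ++ t))) ?(sub t (undup (s ++ t))) ?undup_uniq // => w;
    by rewrite mem_undup mem_cat => ->; rewrite ?orbT.
move=> [us sP] ut st; rewrite /sum_eval [RHS](bigID (mem s1)) /=.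
rewrite [X in _ + X]big1 ?addr0 => [|w w's]; last first.
  by have [->|/sP] := eqVneq (f w) 0; rewrite ?scale0r // (negbTE w's).
rewrite -[RHS]big_filter; apply: perm_big; apply: uniq_perm => //.
  exact: filter_uniq.
by move=> w; rewrite mem_filter andb_idr //; apply: st.
Qed.

(** A list chosen classically, with default [[::]] when the support is infinite; it makes [endo] a
    function of the series alone. *)
Definition supp f : seq (seq nat) :=
  if pselect (exists s, cover s f) is left ex then projT1 (cid ex) else [::].

(* the algebra endomorphism x_i |-> phi i, meaningful on finitely supported
   series only *)
Definition endo phi f : series k := sum_eval (supp f) phi f.

Lemma fin_cover f : finsupp f -> exists s, cover s f.
Proof. by case=> s sP; exists (undup s); apply: cover_undup. Qed.

Lemma endoE s phi f : cover s f -> endo phi f = sum_eval s phi f.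
Proof.
move=> cs; rewrite /endo /supp; case: pselect => [ex|[]]; last by exists s.
by apply: sum_eval_cover => //; case: (cid ex).
Qed.

Lemma endoD phi f g : finsupp f -> finsupp g ->
  endo phi (f + g) = endo phi f + endo phi g.
Proof.
move=> [s sP] [t tP]; have cs (h : series k) :
    (forall w, h w != 0 -> (w \in s) || (w \in t)) -> cover (undup (s ++ t)) h.
  by move=> hP; apply: cover_undup => w /hP; rewrite mem_cat.
rewrite !(@endoE (undup (s ++ t))) ?sum_evalD //; apply: cs => w.
- by move/tP->; rewrite orbT.
- by move/sP->.
rewrite seriesD; have [->|/sP -> //] := eqVneq (f w) 0.
by rewrite add0r => /tP ->; rewrite orbT.
Qed.

Lemma endoZ phi c f : finsupp f -> endo phi (c *: f) = c *: endo phi f.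
Proof.
move=> /fin_cover[s [us sP]]; rewrite !(@endoE s) ?sum_evalZ //.
split=> // w; rewrite seriesZ => cfw; apply: sP.
by apply: contraNneq cfw => ->; rewrite mulr0.
Qed.

Lemma endo_mon phi w : endo phi (mon w) = word_eval phi w.
Proof.
have mem1 : cover [:: w] (mon w).
  by split=> // v; rewrite inE /mon; case: (v == w); rewrite // eqxx.
by rewrite (endoE _ mem1) sum_eval_mon ?inE.
Qed.

Lemma endo_var phi i : endo phi (mon [:: i]) = phi i.
Proof. by rewrite endo_mon /word_eval big_seq1. Qed.

Lemma endo1 phi : endo phi 1 = 1.
Proof. by rewrite -mon_nil endo_mon /word_eval big_nil. Qed.

Lemma endo0 phi : endo phi 0 = 0.
Proof. by rewrite /endo sum_eval0. Qed.

Lemma fin_mon w : finsupp (mon w).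
Proof. by exists [:: w] => v; rewrite inE /mon; case: (v == w); rewrite // eqxx. Qed.

Lemma endo_sum phi (T : Type) (r : seq T) (F : T -> series k) :
  (forall i, finsupp (F i)) ->
  endo phi (\sum_(i <- r) F i) = \sum_(i <- r) endo phi (F i).
Proof.
move=> finF; elim: r => [|i r IHr]; first by rewrite !big_nil endo0.
by rewrite !big_cons endoD ?IHr //; apply: fin_sum.
Qed.

(** Expansion into monomials reduces this to the evaluation of a concatenated word. *)
Lemma endoM phi f g : finsupp f -> finsupp g ->
  endo phi (f * g) = endo phi f * endo phi g.
Proof.
move=> /fin_cover[s cs] /fin_cover[t ct].
have finZmon c w : finsupp (c *: mon w) by apply/finZ/fin_mon.
rewrite {1}(cover_sum cs) {1}(cover_sum ct) big_distrl endo_sum => [|u]; last first.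
  by apply: finM => //; apply: fin_sum.
rewrite (endoE _ cs) (endoE _ ct) /sum_eval big_distrl /=; apply: eq_bigr => u _.
rewrite !big_distrr endo_sum => [|v]; last exact: finM.
apply: eq_bigr => v _; rewrite /= -!scalerAl -!scalerAr -mon_cat.
rewrite !endoZ ?endo_mon //; last exact: fin_mon.
by rewrite /word_eval big_cat.
Qed.

Lemma endo_prod phi (T : Type) (r : seq T) (F : T -> series k) :
  (forall i, finsupp (F i)) ->
  endo phi (\prod_(i <- r) F i) = \prod_(i <- r) endo phi (F i).
Proof.
move=> finF; elim: r => [|i r IHr]; first by rewrite !big_nil endo1.
by rewrite !big_cons endoM ?IHr //; apply: fin_prod.
Qed.

Lemma endo_poly phi f : (forall i, is_poly (phi i)) -> is_poly f ->
  is_poly (endo phi f).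
Proof.
move=> Pphi [f0 /fin_cover[s cs]]; rewrite (endoE _ cs); apply: poly_sum => -[|a w].
  by rewrite f0 scale0r; apply: poly0.
apply: polyZ; rewrite /word_eval big_cons; apply: polyM_finr => //.
by apply: fin_prod => i; apply: poly_fin.
Qed.

Lemma endo_symm d phi (u : nat -> series k) : (forall i, finsupp (u i)) ->
  endo phi (symm d u) = symm d (fun i => endo phi (u i)).
Proof.
move=> fu; rewrite /symm endo_sum => [|s]; last by apply: fin_prod.
by apply: eq_bigr => s _; rewrite endo_prod.
Qed.

Lemma endo_powS d n phi f : (forall i, is_poly (phi i)) ->
  powS d n f -> powS d n (endo phi f).
Proof.
move=> Pphi; elim=> {n f} [n|n x y Sx Px Sy Py|n c x Sx Px||n x u Sx Px Pu].
- by rewrite endo0; apply: powS0.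
- by rewrite endoD; [apply: powSD | apply: fin_powS Sx | apply: fin_powS Sy].
- by rewrite endoZ; [apply: powSZ | apply: fin_powS Sx].
- by rewrite endo1; apply: powS_one.
rewrite endoM; [|exact: fin_powS Sx|exact: fin_symm].
rewrite endo_symm => [|i]; last exact: poly_fin.
by apply: powS_symm => // i; apply: endo_poly.
Qed.

Lemma evalwE phi w : w != [::] -> evalw phi w = word_eval phi w.
Proof.
rewrite /word_eval; elim: w => // a [|b w] IHw _; first by rewrite big_seq1.
by rewrite big_cons -IHw.
Qed.

Lemma subst_onE s phi f : is_poly f -> cover s f ->
  subst_on s phi f = endo phi f.
Proof.
move=> [f0 _] cs; rewrite (endoE _ cs); apply/funext => v.
(* [evalw] and [word_eval] differ at the empty word, where the coefficient of [f] vanishes. *)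
rewrite /sum_eval series_sum; apply: eq_bigr => -[|a w] _.
  by rewrite f0 seriesZ !mul0r.
by rewrite evalwE.
Qed.

End Substitution.

(** * T-spaces and a single generator for each S^n *)

Section TSpaces.
Variables (k : fieldType) (d : nat).
Hypothesis d_gt0 : (0 < d)%N.

Lemma Tspace_lin (V : fpoly k -> Prop) : is_Tspace V -> @lin_closed k V.
Proof. by case. Qed.

Lemma Tspace_endo (V : fpoly k -> Prop) (phi : nat -> series k) (f : series k) :
  is_Tspace V -> (forall i, is_poly (phi i)) -> V f -> V (endo phi f).
Proof.
case=> [Vpoly _ _ _ Vsubst] Pphi Vf; have [f0 ff] := Vpoly f Vf.
have [s cs] := fin_cover ff; have [us sP] := cs.
by rewrite -(@subst_onE _ s) //; apply: Vsubst.
Qed.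

(** For d = 0 the symmetrised product would be 1; positivity of [d] gives every product a first
    factor. *)
Lemma symm_poly (u : nat -> series k) :
  (forall i, is_poly (u i)) -> is_poly (symm d u).
Proof.
move=> Pu; apply: poly_sum => s; case: d d_gt0 s => // d' _ s.
rewrite big_ord_recl; apply: polyM_finr => //.
by apply: fin_prod => i; apply: poly_fin.
Qed.

Lemma powS_poly n (f : series k) : (0 < n)%N -> powS d n f -> is_poly f.
Proof.
case: n => // n _; apply: powS_succ_ind => [|x u Sx Pu].
  by split; [exact: poly0 | exact: polyD | exact: polyZ].
by apply: polyM_finl; [exact: fin_powS Sx | exact: symm_poly].
Qed.

Lemma powS_Tspace n : (0 < n)%N -> is_Tspace (powS d n : fpoly k -> Prop).
Proof.
move=> n_gt0; split.
- by move=> f; apply: powS_poly.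
- exact: powS0.
- by move=> f g; apply: powSD.
- by move=> c f; apply: powSZ.
move=> phi Pphi f s Sf us sP.
by rewrite subst_onE //; [exact: endo_powS | exact: powS_poly Sf].
Qed.

(** The generic n-fold product: disjoint blocks of [d] variables let the factors be specialised
    independently. *)
Definition gen n : series k :=
  \prod_(j < n) symm d (fun i => mon k [:: j * d + i]%N).

Lemma mon_var_poly i : is_poly (mon k [:: i]).
Proof. by split; last exact: fin_mon. Qed.

Lemma gen_powS n : powS d n (gen n).
Proof.
elim: n => [|n IHn]; first by rewrite /gen big_ord0; apply: powS_one.
by rewrite /gen big_ord_recr; apply: powS_symm => // i; apply: mon_var_poly.
Qed.

Lemma powS_prod_ind n (V : series k -> Prop) : lin_closed V ->
  (forall u : nat -> nat -> series k, (forall j i, is_poly (u j i)) ->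
     V (\prod_(j < n) symm d (u j))) ->
  forall x, powS d n x -> V x.
Proof.
move=> linV Vprod x Sx; elim: Sx V linV Vprod => {n x}
    [n|n x y _ Vx _ Vy|n c x _ Vx||n x u _ Vx Pu] V linV Vprod;
  have [V0 VD VZ] := linV => //.
- by apply: VD; [apply: Vx | apply: Vy].
- by apply: VZ; apply: Vx.
- by have := Vprod (fun _ _ => 0); rewrite big_ord0; apply=> *; apply: poly0.
apply: (Vx (fun z => V (z * symm d u))) => [|v Pv]; first exact: lin_closed_mulr.
(* The family [v] is continued by [u] at index [n]. *)
have := Vprod (fun j => if (j < n)%N then v j else u).
rewrite big_ord_recr /= ltnn.
under eq_bigr => j _ do rewrite ltn_ord.
by apply=> j i; case: ifP.
Qed.

Lemma powS_sub_Tspace n (V : fpoly k -> Prop) : is_Tspace V -> V (gen n) ->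
  forall x : series k, powS d n x -> V x.
Proof.
move=> TV Vgen; apply: powS_prod_ind => [|u Pu]; first exact: Tspace_lin.
(* Variable [m] sits in block [m %/ d] at place [m %% d], which dictates its image. *)
have -> : \prod_(j < n) symm d (u j) = endo (fun m => u (m %/ d)%N (m %% d)%N) (gen n).
  rewrite /gen endo_prod => [|j]; last first.
    by apply: fin_symm => i; apply: mon_var_poly.
  apply: eq_bigr => j _; rewrite endo_symm => [|i]; last exact: fin_mon.
  apply: eq_symm => i lt_id.
  by rewrite endo_var divnMDl // modnMDl divn_small // modn_small // addn0.
by apply: Tspace_endo.
Qed.

Lemma mon_prod (T : Type) (r : seq T) (F : T -> nat) :
  \prod_(i <- r) mon k [:: F i] = mon k [seq F i | i <- r].
Proof.
elim: r => [|i r IHr]; first by rewrite big_nil.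
by rewrite big_cons IHr -mon_cat.
Qed.

Lemma SdE : Sd k d = gen 1.
Proof.
rewrite /gen big_ord1 /symm; apply/funext => w; rewrite series_sum.
apply: eq_bigr => s _.
have -> : \prod_(i < d) mon k [:: 0 * d + s i]%N
    = \prod_(i <- enum 'I_d) mon k [:: val (s i)]
  by rewrite enumT [index_enum 'I_d]unlock.
by rewrite mon_prod.
Qed.

(** The span is already a T-space, which gives one inclusion; for the other it is spanned by
    products of members of the previous space with elements of S. *)
Lemma Sn_powS n (x : series k) : (0 < n)%N -> Sn d n x <-> powS d n x.
Proof.
have S1E (y : series k) : S1 d y <-> powS d 1 y.
  split=> [Sy|Sy V TV VSd].
    by apply: (Sy (powS d 1)) => [|_ ->];
      [exact: powS_Tspace | rewrite SdE; exact: gen_powS].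
  by apply: powS_sub_Tspace Sy => //; rewrite -SdE; apply: VSd.
elim: n x => // -[|n] IHn x _; first exact: S1E.
have {}IHn (y : series k) : Sn d n.+1 y <-> powS d n.+1 y by exact: IHn.
split=> [Sx|Sx V TV VA].
  apply: (Sx (powS d n.+2)); first exact: powS_Tspace.
  by move=> _ [a [b [/IHn Sa /S1E Sb ->]]]; rewrite -addn1; apply: powSM.
move: x Sx; apply: powS_succ_ind => [|y u Sy Pu]; first exact: Tspace_lin.
apply: VA; exists y, (symm d u); split=> //; first exact/IHn.
by apply/S1E; apply: powS1_symm.
Qed.

End TSpaces.

(** * The choice of indices and the finite basis *)

(* Once [c] and [c + g] are available every [c + t * g] is; the least index of
   [I] outside this progression lies at distance [g' < g] above one of its
   terms, so that adding it strictly decreases the gap. *)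
Lemma gap_generators (I : nat -> Prop) g c : (0 < g)%N ->
  exists l : seq nat, [/\ (size l < g)%N, forall i, i \in l -> I i
    & forall C : nat -> Prop,
        (forall n h, (c <= n)%N -> C n -> C (n + h)%N -> C (n + h.*2)%N) ->
        C c -> C (c + g)%N -> (forall i, i \in l -> C i) ->
        forall i, I i -> (c <= i)%N -> C i].
Proof.
elim/ltn_ind: g c => g IHg c g_gt0.
have progC (C : nat -> Prop) :
    (forall n h, (c <= n)%N -> C n -> C (n + h)%N -> C (n + h.*2)%N) ->
    C c -> C (c + g)%N -> forall t, C (c + t * g)%N.
  move=> Cstep Cc Cg t.
  (* Each step consumes two consecutive terms, so the induction carries both. *)
  suff [] : C (c + t * g)%N /\ C (c + t.+1 * g)%N by [].
  elim: t => [|t [Ct Ct1]]; first by rewrite mul0n mul1n addn0.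
  split=> //; have -> : (c + t.+2 * g = c + t * g + g.*2)%N.
    by rewrite !mulSnr -addnn !addnA.
  apply: Cstep => //; first exact: leq_addr.
  by rewrite -addnA -mulSnr.
pose bad m := [&& `[< I m >], (c <= m)%N & ~~ (g %| m - c)%N].
have [[m0 bad0]|no_bad] := pselect (exists m, bad m); last first.
  exists [::]; split=> // C Cstep Cc Cg _ i Ii le_ci.
  have /dvdnP[t it] : (g %| i - c)%N.
    apply/negPn/negP => ndv; case: no_bad; exists i.
    by rewrite /bad le_ci ndv andbT /= andbT; apply/asboolP.
  by rewrite -(subnKC le_ci) it; apply: progC.
have [m /and3P[/asboolP Im le_cm ndvm] min_m] := ex_minnP (ex_intro bad m0 bad0).
(* The recursion restarts at the last term of the progression below [m], with the remainder as its
   gap. *)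
pose t := ((m - c) %/ g)%N; pose g' := ((m - c) %% g)%N.
have g'_gt0 : (0 < g')%N by rewrite lt0n.
have lt_g'g : (g' < g)%N by rewrite ltn_mod.
have mE : m = (c + t * g + g')%N by rewrite -addnA -divn_eq subnKC.
have [l [size_l lI lC]] := IHg g' lt_g'g (c + t * g)%N g'_gt0.
exists (m :: l); split=> [|i|C Cstep Cc Cg Cl i Ii le_ci].
(* The recursive list has fewer than [g'] entries, so adding [m] gives at most [g']. *)
- exact: leq_ltn_trans size_l lt_g'g.
- by rewrite inE => /orP[/eqP ->|/lI].
have [le_c'i|lt_ic'] := leqP (c + t * g)%N i.
  apply: lC => // [n h le_c'n|||j l_j].
  - by apply: Cstep; apply: leq_trans le_c'n; apply: leq_addr.
  - exact: progC.
  - by rewrite -mE; apply: Cl; rewrite mem_head.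
  - by apply: Cl; rewrite inE l_j orbT.
(* An index below the new start is below [m], so by minimality it lies in the progression. *)
have /dvdnP[r ir] : (g %| i - c)%N.
  apply/negPn/negP => ndv; have /min_m : bad i.
    by rewrite /bad le_ci ndv andbT /= andbT; apply/asboolP.
  by rewrite leqNgt mE (leq_trans lt_ic') // leq_addr.
by rewrite -(subnKC le_ci) ir; apply: progC.
Qed.

Lemma inseq_map (k : fieldType) (F : nat -> fpoly k) (l : seq nat) b :
  inseq (map F l) b <-> exists2 i, i \in l & b = F i.
Proof.
elim: l => [|i l IHl] /=; first by split=> // -[].
split=> [[->|/IHl[j lj ->]]|[j]].
- by exists i; rewrite ?mem_head.
- by exists j; rewrite // inE lj orbT.
by rewrite inE => /orP[/eqP ->|lj] bE; [left | right; apply/IHl; exists j].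
Qed.

Theorem theorem3p1 (k : fieldType) (p : nat) (d : nat) (I : nat -> Prop)
    (i1 i2 : nat) :
  p \in [pchar k] -> (0 < d)%N ->
  (forall i, I i -> (0 < i)%N) ->
  I i1 -> I i2 -> (i1 < i2)%N ->
  (forall i, I i -> i = i1 \/ (i2 <= i)%N) ->
  exists B : seq (fpoly k),
    (size B <= (i2 - i1).+1)%N /\
    (forall b, inseq B b -> is_poly b) /\
    (forall f, Tgen (fun b => inseq B b) f <-> Rinf d I f).
Proof.
move=> _ d_gt0 I_gt0 Ii1 Ii2 lt_i12 I_gap.
have g_gt0 : (0 < i2 - i1)%N by rewrite subn_gt0.
have [l [size_l lI lC]] := gap_generators I i1 g_gt0.
(* With at most g - 1 entries in [l], these are at most g + 1 indices. *)
pose ix := [:: i1, i2 & l].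
have ixI i : i \in ix -> I i.
  by rewrite !inE => /or3P[/eqP->|/eqP->|/lI].
exists (map (gen k d) ix); split; first by rewrite size_map.
split=> [b /inseq_map[i /ixI/I_gt0 i_gt0 ->]|f].
  exact: (powS_poly d_gt0 i_gt0 (gen_powS k d i)).
split=> Tf V TV VA; apply: Tf => // b.
  move=> /inseq_map[i /ixI Ii ->]; apply: VA; exists i => //.
  by apply/(Sn_powS d_gt0 _ (I_gt0 i Ii)); apply: gen_powS.
move=> [i Ii /(Sn_powS d_gt0 _ (I_gt0 i Ii)) Sb].
(* The property fed to [gap_generators]; [powS_red] supplies its passage from n and n + h to n +
   2h. *)
pose C n := forall x : series k, powS d n x -> V x.
have Cgen n : n \in ix -> C n.
  move=> ix_n; apply: powS_sub_Tspace => //.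
  by apply: VA; apply/inseq_map; exists n.
suff : C i by apply.
apply: lC => // [n h le_i1n Cn Cnh||||].
- apply: powS_red => //; first exact: Tspace_lin.
  exact: leq_trans (I_gt0 i1 Ii1) le_i1n.
- by apply: Cgen; rewrite mem_head.
- by rewrite subnKC ?(ltnW lt_i12) //; apply: Cgen; rewrite !inE eqxx orbT.
- by move=> j lj; apply: Cgen; rewrite !inE lj !orbT.
- by have [->//|/(leq_trans (ltnW lt_i12))] := I_gap i Ii.
Qed.
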